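(* Let $p,q,a\in\mathbb{Z}$ with $0<q<p$, $0\le a<p$ and $\gcd(p,q)=1$. Let $s\in\{-1,1\}$ and let $c,r,\beta,\gamma$ be integers such that $$p=c\,q+s\,r,\qquad a=\beta\,q-s\,\gamma,\qquad 0\le r<q,\qquad 0\le\gamma<q .$$ Then $$(a(q^{-1})_p)_p=\begin{cases}\dfrac{a}{q}+\dfrac{p}{q}\,(\gamma(r^{-1})_q)_q=\dfrac{a}{q}+\dfrac{p}{q}\,\bigl(-(s\,a)_q((s\,p)^{-1})_q\bigr)_q & \text{if } q>1,\\[6pt] a & \text{if } q=1.\end{cases}$$
   Context: For integers $a$ and $m\neq0$, $(a)_m:=a-m\lfloor a/m\rfloor$. Extended modular inverse: for integers $a,b,m$ with $m\ne 0$ and $d=\gcd(a,m)$, the symbol $(b(a^{-1})_m)_m$ denotes: (i) if $d=1$, $(x)_m$, where $x$ is any integer with $ax\equiv b\pmod m$; (ii) if $d\neq1$ and $d\mid b$, $(x)_{m/d}$, where $x$ is any integer with $(a/d)x\equiv b/d\pmod{m/d}$; (iii) undefined if $d\nmid b$. In particular $(\gamma(r^{-1})_q)_q$ and $(-(sa)_q((sp)^{-1})_q)_q$ are the extended modular inverses modulo $q$ with numerators $\gamma$ and $-(sa)_q$ and denominators $r$ and $sp$ respectively. *)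

(* Defs.v *)
From mathcomp Require Import all_boot all_order all_algebra.
Set Implicit Arguments.
Unset Strict Implicit.
Unset Printing Implicit Defensive.
Import Order.TTheory GRing.Theory Num.Theory.
Local Open Scope ring_scope.

(* The floor residue (a)_m = a - m * floor (a / m).  It has the sign of m, so
   it differs from intdiv's (a %% m)%Z when m < 0. *)
Definition fmod (a m : int) : int := a - m * Num.floor (a%:Q / m%:Q).

Lemma lin_cong_ex (a b m : int) :
  exists x : int, coprimez a m ==> (a * x == b %[mod m])%Z.
Proof.
have [cop|] := boolP (coprimez a m); last by exists 0.
have [[u v] /= uv1] := coprimezP _ _ cop.
exists (u * b); rewrite eqz_mod_dvd.
have -> : a * (u * b) - b = - (v * b) * m.
  rewrite -[in X in _ - X](mul1r b) -uv1 mulrDl opprD addrA.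
  rewrite [a * (u * b)]mulrA [a * u]mulrC subrr add0r mulNr; congr (- _).
  by rewrite mulrAC.
exact: dvdz_mull.
Qed.

(* Some solution x of a * x = b modulo m; meaningful for a and m coprime. *)
Definition lin_cong_sol (a b m : int) : int := xchoose (lin_cong_ex a b m).

(* The extended modular inverse (b (a^-1)_m)_m, with None for "undefined".
   It is only meaningful for m != 0; the choice of the solution is then
   irrelevant, by ext_modinv_coprime and ext_modinv_ncoprime below. *)
Definition ext_modinv (b a m : int) : option int :=
  let d := gcdz a m in
  if d == 1 then Some (fmod (lin_cong_sol a b m) m)
  else if (d %| b)%Z then
    Some (fmod (lin_cong_sol (a %/ d)%Z (b %/ d)%Z (m %/ d)%Z) (m %/ d)%Z)
  else None.

Lemma fmod_eqmod (x y m : int) :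
  m != 0 -> (x = y %[mod m])%Z -> fmod x m = fmod y m.
Proof.
move=> m0 /eqP; rewrite eqz_mod_dvd => /dvdzP[k /eqP].
rewrite subr_eq => /eqP ->; rewrite /fmod.
have mQ : m%:Q != 0 by rewrite intr_eq0.
rewrite rmorphD rmorphM /= mulrDl mulfK // floorDzr ?intrKfloor.
  by rewrite mulrDr [k * m]mulrC opprD addrACA subrr add0r.
exact: intr_int.
Qed.

Lemma lin_cong_sol_fmod (a b m x : int) :
  m != 0 -> coprimez a m -> (a * x = b %[mod m])%Z ->
  fmod (lin_cong_sol a b m) m = fmod x m.
Proof.
move=> m0 cop ax; apply: fmod_eqmod => //.
have /implyP/(_ cop)/eqP ay := xchooseP (lin_cong_ex a b m).
apply/eqP; rewrite eqz_mod_dvd -(@Gauss_dvdzr m a) 1?coprimez_sym //.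
  by rewrite mulrBr -eqz_mod_dvd ay ax.
Qed.

Lemma ext_modinv_coprime (b a m x : int) :
  m != 0 -> gcdz a m = 1 -> (a * x = b %[mod m])%Z ->
  ext_modinv b a m = Some (fmod x m).
Proof.
move=> m0 d1 ax; rewrite /ext_modinv d1 eqxx; congr Some.
by apply: lin_cong_sol_fmod => //; rewrite /coprimez d1.
Qed.

Lemma ext_modinv_ncoprime (b a m x : int) (d := gcdz a m) :
  m != 0 -> d != 1 -> (d %| b)%Z ->
  ((a %/ d)%Z * x = (b %/ d)%Z %[mod (m %/ d)%Z])%Z ->
  ext_modinv b a m = Some (fmod x (m %/ d)%Z).
Proof.
move=> m0 d1 db ax; rewrite /ext_modinv -/d (negPf d1) db; congr Some.
have d0 : d != 0 by rewrite gcdz_eq0 negb_and m0 orbT.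
have md : (m %/ d)%Z * d = m by rewrite divzK // dvdz_gcdr.
have ad : (a %/ d)%Z * d = a by rewrite divzK // dvdz_gcdl.
apply: lin_cong_sol_fmod => //.
  by apply: contra_neq m0 => e; rewrite -md e mul0r.
rewrite /coprimez -(inj_eq (mulIf d0)) mul1r.
have dd : d = `|d| by rewrite ger0_norm.
by rewrite {3}dd mulz_gcdl ad md -/d.
Qed.

Lemma ext_modinv_undef (b a m : int) :
  ~~ (gcdz a m %| b)%Z -> ext_modinv b a m = None.
Proof.
rewrite /ext_modinv; case: eqP => [->|_]; first by rewrite dvd1z.
by move/negPf->.
Qed.

(* Main.v *)
Require Import Defs.
From mathcomp Require Import all_boot all_order all_algebra.
From mathcomp Require Import ring zify.
Import Order.TTheory GRing.Theory Num.Theory.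
Local Open Scope ring_scope.

(** Reducing [p = c q + s r] and [a = beta q - s gamma] modulo [q] shows that
    [r v = gamma], [s p v = - s a] and [a + p v = 0] modulo [q] are the same
    congruence in [v], because [s = -1] or [s = 1]. If [0 <= v < q] is its solution, then
    [u = (a + p v) / q] is an integer, lies in [0, p) since
    [a + p v <= (p - 1) + p (q - 1) < p q], and satisfies [q u = a] modulo
    [p]. *)

Lemma fmod_small (x m : int) : 0 <= x < m -> fmod x m = x.
Proof.
move=> /andP[x0 xm]; have m0 : 0 < m%:Q by rewrite ltr0z (le_lt_trans x0).
have floor0 : Num.floor (x%:Q / m%:Q) = 0.
  apply: floor_def; rewrite add0r ltr_pdivrMr // mul1r ltr_int xm andbT.
  by rewrite divr_ge0 ?ler0z // (le_trans x0) // ltW.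
by rewrite /fmod floor0 mulr0 subr0.
Qed.

(** For coprime denominator and modulus, this reduces evaluating an inverse to a range check and a
    congruence; all three inverses of the theorem are found this way. *)
Lemma ext_modinv_small (b a m x : int) :
  gcdz a m = 1 -> 0 <= x < m -> (a * x = b %[mod m])%Z ->
  ext_modinv b a m = Some x.
Proof.
move=> d1 xm ax; rewrite (@ext_modinv_coprime _ _ _ x) ?fmod_small //.
by case/andP: xm => x0 xm; rewrite gt_eqF // (le_lt_trans x0).
Qed.

Lemma lin_cong_small_ex (a b m : int) : 0 < m -> gcdz a m = 1 ->
  exists2 x : int, 0 <= x < m & (a * x = b %[mod m])%Z.
Proof.
move=> m0 d1; have [x] := lin_cong_ex a b m.
rewrite /coprimez d1 /= => /eqP ax; exists (x %% m)%Z.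
  by rewrite modz_ge0 ?ltz_pmod ?gt_eqF.
by rewrite modzMmr.
Qed.

Lemma fmod_eqmodE (x m : int) : (fmod x m = x %[mod m])%Z.
Proof.
by apply/esym/eqP; rewrite eqz_mod_dvd /fmod subKr dvdz_mulr.
Qed.

Lemma gcdz_sign_mull (s a m : int) : s = -1 \/ s = 1 ->
  gcdz (s * a) m = gcdz a m.
Proof. by case=> ->; rewrite ?mulN1r ?gcdNz ?mul1r. Qed.

Theorem theorem3p2 (p q a s c r beta gamma : int)
  (q_gt0 : 0 < q) (q_lt_p : q < p)
  (a_ge0 : 0 <= a) (a_lt_p : a < p)
  (pq_coprime : gcdz p q = 1)
  (s_sign : s = -1 \/ s = 1)
  (p_eq : p = c * q + s * r)
  (a_eq : a = beta * q - s * gamma)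
  (r_ge0 : 0 <= r) (r_lt_q : r < q)
  (gamma_ge0 : 0 <= gamma) (gamma_lt_q : gamma < q) :
  exists2 u : int, ext_modinv a q p = Some u &
    (1 < q ->
       exists v w : int,
         [/\ ext_modinv gamma r q = Some v,
             ext_modinv (- fmod (s * a) q) (s * p) q = Some w,
             u%:Q = a%:Q / q%:Q + p%:Q / q%:Q * v%:Q
           & a%:Q / q%:Q + p%:Q / q%:Q * v%:Q =
             a%:Q / q%:Q + p%:Q / q%:Q * w%:Q])
    /\ (q = 1 -> u = a).
Proof.
(* Neither the sign [s] nor adding [c * q] changes the gcd with [q], and [c * q + s * r] is [p]. *)
have rq1 : gcdz r q = 1.
  rewrite -(gcdz_sign_mull s r q s_sign) gcdzC -(gcdzMDl c).
  by rewrite -p_eq gcdzC.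
have [v v_bnd rv] := lin_cong_small_ex r gamma q q_gt0 rq1.
have /dvdzP[k kE] : (q %| r * v - gamma)%Z by rewrite -eqz_mod_dvd; apply/eqP.
(* This is the quotient of [a + p * v = q * (beta + c * v) + s * (r * v - gamma)] by [q], using
   [r * v - gamma = k * q]. *)
pose u := beta + c * v + s * k.
have quE : q * u = a + p * v.
  have -> : a + p * v = beta * q + c * q * v + s * (r * v - gamma).
    by rewrite a_eq p_eq; ring.
  by rewrite kE /u; ring.
have u_bnd : 0 <= u < p by case/andP: v_bnd => v0 vq; nia.
exists u.
  apply: ext_modinv_small; rewrite 1?gcdzC //.
  by rewrite quE addrC mulrC modzMDl.
split=> [_|q1]; last first.
  (* For [q = 1] the range [0 <= v < q] leaves a single value. *)
  have v0 : v = 0 by lia.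
  by move: quE; rewrite q1 v0 mul1r mulr0 addr0.
exists v, v; split=> //.
- exact: ext_modinv_small.
- apply: ext_modinv_small => //; first by rewrite gcdz_sign_mull.
  (* Modulo [q] the residue [fmod (s * a) q] may be replaced by [s * a]; the difference of the two
     sides is then [s * (q * u)]. *)
  apply/eqP; rewrite -modzNm fmod_eqmodE modzNm eqz_mod_dvd.
  have -> : s * p * v - - (s * a) = s * (a + p * v) by ring.
  by rewrite -quE mulrCA dvdz_mulr.
- have q0 : q%:Q != 0 by rewrite intr_eq0 gt_eqF.
  apply: (mulfI q0); rewrite -intrM quE rmorphD rmorphM /=.
  by field.
Qed.
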